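(* Let $c_1=\langle P_1,\mathbf{d}_1,\mathcal{E}_1\rangle$ and $c_2=\langle P_2,\mathbf{d}_2,\mathcal{E}_2\rangle$ be configurations over the same data space $\mathcal{D}$, let $i\ge0$, let $\rho_i:\mathcal{D}\to[0,1]$ be an $i$-penalty function, and let $\ell\ge1$ be an integer. For each $N\ge1$, let $c_1^1,\dots,c_1^N$ be independent samples drawn from $\mathcal{S}^{\mathcal{C}}_{c_1,i}$ and $c_2^1,\dots,c_2^{\ell N}$ independent samples drawn from $\mathcal{S}^{\mathcal{C}}_{c_2,i}$, where $c_1^j=\langle P_1^j,\mathbf{d}_1^j,\mathcal{E}_1\rangle$ and $c_2^h=\langle P_2^h,\mathbf{d}_2^h,\mathcal{E}_2\rangle$; let $\omega_1\le\dots\le\omega_N$ be the values $\rho_i(\mathbf{d}_1^j)$ sorted in non-decreasing order and $\nu_1\le\dots\le\nu_{\ell N}$ the values $\rho_i(\mathbf{d}_2^h)$ sorted in non-decreasing order. Then, almost surely, $$\mathbf{W}(m^{\mathcal{D}}_{\rho,i})\big(\mathcal{S}^{\mathcal{D}}_{c_1,i},\mathcal{S}^{\mathcal{D}}_{c_2,i}\big)=\lim_{N\to\infty}\frac{1}{\ell N}\sum_{h=1}^{\ell N}\max\Big\{\nu_h-\omega_{\lceil h/\ell\rceil},0\Big\}.$$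
   Context: A data space is $\mathcal{D}=\prod_{k=1}^n\mathcal{D}_{x_k}$, each $\mathcal{D}_{x_k}\subseteq\mathbb{R}$ a finite set or a compact subset of $\mathbb{R}$, with the product Borel $\sigma$-algebra $\mathcal{B}_{\mathcal{D}}$. A configuration $\langle P,\mathbf{d},\mathcal{E}\rangle$ consists of a process $P$ of a probabilistic process calculus (set of processes $\mathcal{P}$, with power-set $\sigma$-algebra $\Sigma_{\mathcal{P}}$), a data state $\mathbf{d}\in\mathcal{D}$, and an environment evolution $\mathcal{E}:\mathcal{D}\to\Pi(\mathcal{D},\mathcal{B}_{\mathcal{D}})$ (with $\mathbf{d}\mapsto\mathcal{E}(\mathbf{d})(\mathbb{D})$ measurable for each $\mathbb{D}$). For fixed $\mathcal{E}$, the configuration space $\mathcal{C}$ is identified with $\mathcal{P}\times\mathcal{D}$, with $\sigma$-algebra $\Sigma_{\mathcal{C}}=\Sigma_{\mathcal{P}}\otimes\mathcal{B}_{\mathcal{D}}$. Each configuration $c$ determines a sequence of probability distributions $\mathcal{S}^{\mathcal{C}}_{c,i}$ ($i\ge0$) on $(\mathcal{C},\Sigma_{\mathcal{C}})$, its multi-step behaviour, defined by $\mathcal{S}^{\mathcal{C}}_{c,0}=\delta_c$ and $\mathcal{S}^{\mathcal{C}}_{c,i+1}(\mathbb{C})=\int_{\mathcal{C}}\mathsf{cstep}(b)(\mathbb{C})\,\mathrm{d}\mathcal{S}^{\mathcal{C}}_{c,i}(b)$ for the one-step Markov kernel $\mathsf{cstep}$ of the calculus; its evolution sequence consists of the distributions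 $\mathcal{S}^{\mathcal{D}}_{c,i}$ on $(\mathcal{D},\mathcal{B}_{\mathcal{D}})$ with $\mathcal{S}^{\mathcal{D}}_{c,i}(\mathbb{D})=\mathcal{S}^{\mathcal{C}}_{c,i}(\mathcal{P}\times\mathbb{D})$. An $i$-penalty function is a continuous function $\rho_i:\mathcal{D}\to[0,1]$, and $m^{\mathcal{D}}_{\rho,i}(\mathbf{d},\mathbf{d}')=\max\{\rho_i(\mathbf{d}')-\rho_i(\mathbf{d}),0\}$. For distributions $\mu,\nu$ on $(\mathcal{D},\mathcal{B}_{\mathcal{D}})$, $\mathbf{W}(m)(\mu,\nu)=\inf_{\mathfrak{w}\in\mathfrak{W}(\mu,\nu)}\int_{\mathcal{D}\times\mathcal{D}}m(\mathbf{d},\mathbf{d}')\,\mathrm{d}\mathfrak{w}(\mathbf{d},\mathbf{d}')$, where $\mathfrak{W}(\mu,\nu)$ is the set of probability measures on $\mathcal{D}\times\mathcal{D}$ with left marginal $\mu$ and right marginal $\nu$. *)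

(* Defs.v *)
From HB Require Import structures.
From mathcomp Require Import all_boot all_order all_algebra.
From mathcomp Require Import all_classical all_reals all_analysis.

Set Implicit Arguments.
Unset Strict Implicit.
Unset Printing Implicit Defensive.

Import Order.TTheory GRing.Theory Num.Theory.
Import numFieldNormedType.Exports.

Local Open Scope classical_set_scope.
Local Open Scope ring_scope.

(* The factors are required to be nonempty because a measurableType is pointed;
   over an empty data space there would be no configuration at all. *)
Record dataSpace (R : realType) := DataSpace {
  nvars : nat ;
  dom : 'I_nvars -> set R ;
  dom_finite_or_compact : forall k, finite_set (dom k) \/ compact (dom k) ;
  dom_nonempty : forall k, dom k !=set0 }.

Arguments dom {R} d k.

Section data_state.
Context {R : realType} (S : dataSpace R).

Definition domains : set 'rV[R]_(nvars S) := [set x | forall k, dom S k (x 0 k)].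

Definition dataState : Type := set_type domains.

HB.instance Definition _ := Choice.on dataState.
HB.instance Definition _ := Topological.copy dataState (set_type domains).

Lemma domains_point :
  (\row_k xget 0 (dom S k) : 'rV[R]_(nvars S)) \in domains.
Proof.
by rewrite inE => k; rewrite mxE; exact: xgetPex (dom_nonempty (d := S) k).
Qed.

HB.instance Definition _ := isPointed.Build dataState
  (@exist _ (fun x => x \in domains) _ domains_point).

Definition variable_value (k : 'I_(nvars S)) (d : dataState) :
    measurableTypeR R :=
  set_val d 0 k.

(* The product of the Borel sigma-algebras of the factors: the Borel sets of
   dom k are the traces of those of R. *)
Definition dataState_measurable : set_system dataState :=
  g_sigma_preimage variable_value.

Definition dataState_display : measure_display.
Proof. by constructor. Qed.

HB.instance Definition _ := @isMeasurable.Build dataState_display dataState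
  dataState_measurable (@sigma_algebra0 _ _ _)
  (@sigma_algebraC _ _) (@sigma_algebra_bigcup _ _ _).

End data_state.

Record configuration {R : realType} dP (P : measurableType dP)
    (S : dataSpace R) := Configuration {
  process : P ;
  state : dataState S ;
  evolution : R.-pker dataState S ~> dataState S }.

Section kernel_step.
Local Open Scope ereal_scope.
Context {R : realType} d (T : measurableType d).
Variables (mu : probability T R) (k : R.-pker T ~> T).

Definition kstep (A : set T) : \bar R := \int[mu]_b k b A.

Let kstep0 : kstep set0 = 0.
Proof. by apply: integral0_eq => b _; rewrite measure0. Qed.

Let kstep_ge0 A : 0 <= kstep A.
Proof. exact: integral_ge0. Qed.

Let kstep_sigma_additive : semi_sigma_additive kstep.
Proof.
move=> F mF tF mUF; rewrite [X in _ --> X](_ : _ = \sum_(n <oo) kstep (F n)).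
  by apply: is_cvg_ereal_nneg_natsum => n _; exact: kstep_ge0.
rewrite /kstep -integral_nneseries//; last by move=> n; exact: measurable_kernel.
by apply: eq_integral => b _; rewrite measure_semi_bigcup.
Qed.

HB.instance Definition _ :=
  isMeasure.Build d T R kstep kstep0 kstep_ge0 kstep_sigma_additive.

Let kstep_setT : kstep setT = 1.
Proof.
rewrite /kstep; under eq_integral do rewrite prob_kernel.
by rewrite integral_cst// mul1e; exact: probability_setT.
Qed.

HB.instance Definition _ := Measure_isProbability.Build d T R kstep kstep_setT.

End kernel_step.

Section evolution_sequence.
Context {R : realType} dP (P : measurableType dP) (S : dataSpace R).
(* cstep E is the one-step kernel of the calculus under the environment E; the
   configurations with that environment are identified with P * dataState S. *)
Variable cstep : (R.-pker dataState S ~> dataState S) ->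
  R.-pker (P * dataState S)%type ~> (P * dataState S)%type.
Variable c : configuration P S.

Fixpoint multistep (i : nat) : probability (P * dataState S)%type R :=
  if i is i'.+1 then kstep (multistep i') (cstep (evolution c))
  else dirac (process c, state c).

HB.instance Definition _ := @isMeasurableFun.Build _ _ (P * dataState S)%type
  (dataState S) snd measurable_snd.

Definition evolution_sequence (i : nat) : probability (dataState S) R :=
  distribution (multistep i) snd.

End evolution_sequence.

Section wasserstein.
Local Open Scope ereal_scope.
Context {R : realType} d (T : measurableType d).

Definition coupling (mu nu : probability T R) :
    set (probability (T * T)%type R) :=
  [set w | forall A, measurable A ->
     w (A `*` setT) = mu A /\ w (setT `*` A) = nu A].

Definition wasserstein (m : T -> T -> R) (mu nu : probability T R) : \bar R :=
  ereal_inf [set \int[w]_p (m p.1 p.2)%:E | w in coupling mu nu].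

End wasserstein.

Section penalty.
Context {R : realType} (S : dataSpace R).

Definition penalty_function (rho : dataState S -> R) : Prop :=
  continuous rho /\ forall d, 0 <= rho d <= 1.

Definition penalty_hemimetric (rho : dataState S -> R)
    (d d' : dataState S) : R :=
  Num.max (rho d' - rho d) 0.

End penalty.

Section sampling.
Context {R : realType} dO (O : measurableType dO) (Pr : probability O R).
Context dT (T : measurableType dT).

Definition mutually_independent (I : finType) (X : I -> {RV Pr >-> T}) : Prop :=
  forall (J : {set I}) (A : I -> set T), (forall j, measurable (A j)) ->
    Pr (\bigcap_(j in [set` J]) X j @^-1` A j) =
    (\prod_(j in J) Pr (X j @^-1` A j))%E.

Definition independent_samples (mu : probability T R) (I : finType)
    (X : I -> {RV Pr >-> T}) : Prop :=
  mutually_independent X /\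
  forall j (A : set T), measurable A -> distribution Pr (X j) A = mu A.

End sampling.

(* The h-th smallest element of s, with h counted from 1. *)
Definition order_stat {R : realType} (s : seq R) (h : nat) : R :=
  nth 0 (sort <=%R s) h.-1.

(* (l * N)^-1 * \sum_(h = 1)^(l * N) max (nu_h - omega_ceil(h / l), 0), where
   omega and nu are the two samples in nondecreasing order. *)
Definition estimator {R : realType} (l N : nat) (x : 'I_N -> R)
    (y : 'I_(l * N) -> R) : R :=
  let omega := order_stat (codom x) in
  let nu := order_stat (codom y) in
  (l * N)%:R^-1 * \sum_(1 <= h < (l * N).+1)
    Num.max (nu h - omega `|Num.ceil (h%:R / l%:R : R)|%N) 0.

(* Main.v *)
(* For x, y in [0, 1] the cost max (y - x, 0) is the integral over t of the
   indicator of x <= t < y, hence within 1/M of the corresponding Riemann sum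
   over the thresholds k/M.  On the sample side, counting the order statistics
   below a threshold turns the estimator, up to 1/M, into the mean over k of
   max (F_N (k/M) - G_N (k/M), 0), where F_N and G_N are the empirical
   distribution functions of the penalties.  On the Wasserstein side, every
   coupling w satisfies w (rho <= t < rho') >= F t - G t, with equality at all
   thresholds k/M simultaneously for a coupling that pairs the level cells
   monotonically and is a product inside each pair of cells; so the distance is,
   up to 1/M, the same mean with the true distribution functions F and G.
   It remains to let N tend to infinity at countably many thresholds.  The
   samples for different N are unrelated (a triangular array), so the law of
   large numbers comes from Chernoff bounds and the Borel-Cantelli lemma. *)

Require Import Defs.
From HB Require Import structures.
From mathcomp Require Import all_boot all_order all_algebra.
From mathcomp Require Import all_classical all_reals all_analysis.
From mathcomp Require Import measurable_realfun zify ring lra.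

Set Implicit Arguments.
Unset Strict Implicit.
Unset Printing Implicit Defensive.

Import Order.TTheory GRing.Theory Num.Theory.
Import numFieldNormedType.Exports.

Local Open Scope classical_set_scope.
Local Open Scope ring_scope.

(** * Riemann sums over the thresholds k/M *)

Definition levels (R : realType) (M : nat) (x y : R) : R :=
  M%:R^-1 * \sum_(k < M) ((x <= k%:R / M%:R) && (k%:R / M%:R < y))%:R.

(** Riemann sum of the integral over [0, 1] of the positive part of [F - G]. Only values at the
    thresholds enter, so limits are needed there alone. *)
Definition grid_gap (R : realType) (M : nat) (F G : R -> R) : R :=
  M%:R^-1 * \sum_(k < M) Num.max (F (k%:R / M%:R) - G (k%:R / M%:R)) 0.

(** The sum counts the naturals below [u], so it is the ceiling of [u]; [u <= m] keeps the count
    from being cut short. *)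
Lemma sum_lt_bounds (R : realType) (m : nat) (u : R) : 0 <= u <= m%:R ->
  u <= \sum_(k < m) (k%:R < u)%R%:R <= u + 1.
Proof.
elim: m => [|m IH] /andP[u0 um]; first by rewrite big_ord0; lra.
rewrite big_ord_recr/=; have [mu|um'] := ltP m%:R u; last first.
  by rewrite addr0 IH// u0 um'.
have -> : \sum_(k < m) (k%:R < u)%R%:R = m%:R :> R.
  rewrite (eq_bigr (fun=> 1)) ?big_const_ord ?iter_addr_0// => k _.
  by rewrite (lt_trans _ mu)// ltr_nat.
by move: um; rewrite -natr1 mulr1n; lra.
Qed.

(** Rounding an endpoint up to the grid errs by an amount in [0, 1/M]. Both errors have the same
    sign, so their difference is at most 1/M and not 2/M. *)
Lemma levels_approx (R : realType) (M : nat) (x y : R) : (0 < M)%N ->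
  0 <= x <= 1 -> 0 <= y <= 1 ->
  `|Num.max (y - x) 0 - levels M x y| <= M%:R^-1.
Proof.
move=> M0 x01 y01; have M0' : (0 : R) < M%:R by rewrite ltr0n.
have scale (z : R) : 0 <= z <= 1 -> z <= M%:R^-1 *
    \sum_(k < M) (k%:R / M%:R < z)%R%:R <= z + M%:R^-1.
  move=> z01; have /(@sum_lt_bounds _ M) : 0 <= z * M%:R <= M%:R by nra.
  under eq_bigr do rewrite -ltr_pdivrMr//.
  rewrite ler_pdivlMl// [_ * z]mulrC => /andP[->/=].
  by rewrite ler_pdivrMl// mulrDr mulfV ?gt_eqF// [M%:R * z]mulrC.
rewrite /levels; case: (leP y x) => [yx|xy].
  rewrite big1 ?mulr0 ?subr0; last first.
    move=> k _; apply/eqP; rewrite pnatr_eq0 eqb0; apply/negP => /andP[xk ky].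
    by move: (le_lt_trans xk ky); rewrite ltNge yx.
  have -> : Num.max (y - x) 0 = 0 by apply/max_idPr; lra.
  by rewrite normr0 invr_ge0 ltW.
have -> : Num.max (y - x) 0 = y - x by apply/max_idPl; lra.
rewrite (eq_bigr (fun k : 'I_M => (k%:R / M%:R < y)%R%:R - (k%:R / M%:R < x)%R%:R));
  last first.
  move=> k _; case: (leP x) => /= [xk|kx]; first by rewrite subr0.
  by rewrite (lt_trans kx xy) subrr.
rewrite sumrB mulrBr; move: (scale _ x01) (scale _ y01).
by rewrite ler_norml; lra.
Qed.

(** * Order statistics and the estimator *)

Lemma nth_sorted_le (R : realType) (s : seq R) (t : R) (i : nat) :
  sorted <=%R s -> (i < size s)%N ->
  (nth 0 s i <= t) = (i < count (fun z => (z <= t)%R) s)%N.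
Proof.
elim: s i => [|a s IH] i //= ps.
have as_ : all (fun z => a <= z) s.
  by apply: order_path_min ps => ? ? ?; exact: le_trans.
have [at_|ta] := leP a t.
  by case: i => [|i] //= si; rewrite IH ?(path_sorted ps)// add1n ltnS.
have -> : count (fun z => (z <= t)%R) s = 0%N.
  apply/eqP; rewrite -leqn0 leqNgt -has_count -all_predC.
  by apply: sub_all as_ => z /= az; rewrite -ltNge (lt_le_trans ta).
case: i => [|i] /= si; first by rewrite leNgt ta.
rewrite ltn0; apply/negbTE; rewrite -ltNge (lt_le_trans ta)//.
by move/(all_nthP 0) : as_; apply.
Qed.

Lemma order_stat_le (R : realType) (s : seq R) (t : R) (h : nat) :
  (0 < h <= size s)%N ->
  (order_stat s h <= t) = (h <= count (fun z => (z <= t)%R) s)%N.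
Proof.
move=> /andP[h0 hs]; rewrite /order_stat nth_sorted_le.
- have /permP -> : perm_eq (sort <=%R s) s by rewrite perm_sort.
  by rewrite prednK.
- by apply: sort_sorted => x y; exact: le_total.
- by rewrite size_sort prednK.
Qed.

Definition frequency (R : realType) (n : nat) (b : 'I_n -> bool) : R :=
  n%:R^-1 * (\sum_(j < n) b j)%:R.

Lemma count_codom (n : nat) (T : eqType) (x : 'I_n -> T) (p : pred T) :
  count p (codom x) = (\sum_(j < n) p (x j))%N.
Proof.
rewrite codomE count_map -sum1_count big_mkcond/= big_enum/=.
by apply: eq_bigr => j _; case: (p _).
Qed.

(** The interval may be empty; truncated subtraction then gives 0, which matches the positive part
    in [grid_gap]. *)
Lemma sum_nat_interval (R : realType) (n a b : nat) : (b <= n)%N ->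
  \sum_(1 <= h < n.+1) ((a < h) && (h <= b))%N%:R = (b - a)%:R :> R.
Proof.
move=> bn; rewrite -natr_sum; congr (_%:R).
rewrite (@big_cat_nat _ _ _ b.+1)//=.
rewrite [X in (_ + X)%N]big_nat_cond [X in (_ + X)%N]big1 ?addn0; last first.
  by move=> h; rewrite andbT => /andP[bh _]; rewrite [(h <= b)%N]leqNgt bh andbF.
elim: b {bn} => [|b IH]; first by rewrite big_geq.
rewrite big_nat_recr//= leqnn andbT ltnS.
rewrite (eq_big_nat _ _ (F2 := fun h => ((a < h) && (h <= b))%N : nat)).
  by rewrite IH; case: leqP => ?; lia.
by move=> h /andP[_]; rewrite ltnS => hb; rewrite hb (leq_trans hb).
Qed.

Lemma estimator_approx (R : realType) (l N M : nat) (x : 'I_N -> R)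
    (y : 'I_(l * N) -> R) : (0 < l)%N -> (0 < N)%N -> (0 < M)%N ->
  (forall j, 0 <= x j <= 1) -> (forall j, 0 <= y j <= 1) ->
  `|estimator x y - grid_gap M (fun t => frequency R (fun j => x j <= t))
      (fun t => frequency R (fun j => y j <= t))| <= M%:R^-1.
Proof.
move=> l0 N0 M0 x01 y01; rewrite /estimator.
have lN0 : (0 < l * N)%N by rewrite muln_gt0 l0.
have lN0' : (0 : R) < (l * N)%:R by rewrite ltr0n.
set c := fun h : nat => `|Num.ceil (h%:R / l%:R : R)|%N.
(* The ceiling is a left adjoint, which turns a bound on the index of [omega] into a bound on [h]
   itself. *)
have cle h (a : nat) : (c h <= a)%N = (h <= l * a)%N.
  have l0' : (0 : R) < l%:R by rewrite ltr0n.
  have ch0 : 0 <= Num.ceil (h%:R / l%:R : R).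
    by rewrite -(ceil0 R) le_ceil// divr_ge0.
  rewrite -lez_nat /c gez0_abs//.
  by rewrite ceil_le_int -[a%:~R]/(a%:R) ler_pdivrMr// -natrM ler_nat mulnC.
have c1 h : (0 < h)%N -> (0 < c h)%N.
  by rewrite !lt0n; apply: contraNneq => /eqP; rewrite -leqn0 cle muln0 leqn0.
have os01 n (z : 'I_n -> R) h : (forall j, 0 <= z j <= 1) -> (0 < h <= n)%N ->
    0 <= order_stat (codom z) h <= 1.
  move=> z01 /andP[h0 hn].
  have : order_stat (codom z) h \in codom z.
    rewrite -(mem_sort <=%R) mem_nth// size_sort size_codom card_ord.
    by rewrite prednK.
  by move=> /codomP[j ->].
set om := order_stat (codom x); set nu := order_stat (codom y).
have hrange h : (1 <= h < (l * N).+1)%N ->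
    (0 < h <= l * N)%N /\ (0 < c h <= N)%N.
  move=> /andP[h1 h2]; split; first by rewrite h1.
  by rewrite c1//= cle.
have -> : grid_gap M (fun t => frequency R (fun j => x j <= t))
      (fun t => frequency R (fun j => y j <= t)) =
    (l * N)%:R^-1 * \sum_(1 <= h < (l * N).+1) levels M (om (c h)) (nu h).
  rewrite /grid_gap /levels -mulr_sumr mulrCA; congr (_ * _).
  rewrite exchange_big/= mulr_sumr; apply: eq_bigr => k _.
  set t := k%:R / M%:R; set cx := (\sum_j (x j <= t)%R)%N.
  set cy := (\sum_j (y j <= t)%R)%N.
  have cxN : (cx <= N)%N.
    rewrite -[leqRHS]muln1 -[X in (X * _)%N](card_ord N) -sum_nat_const.
    by apply: leq_sum => j _; exact: leq_b1.
  (* At a fixed threshold, [om (c h) <= t] means [h <= l * cx] and [t < nu h] means [cy < h], so the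
     contributing indices form an interval. *)
  rewrite (eq_big_nat _ _ (F2 := fun h => ((cy < h) && (h <= l * cx))%N%:R)).
    rewrite sum_nat_interval ?leq_mul2l ?cxN ?orbT// /frequency -/cx -/cy.
    have -> : N%:R^-1 * cx%:R = (l * N)%:R^-1 * (l * cx)%:R :> R.
      by rewrite !natrM; field; rewrite !pnatr_eq0 -!lt0n l0 N0.
    rewrite -mulrBr -[X in Num.max _ X](mulr0 (l * N)%:R^-1).
    rewrite -maxr_pMr ?invr_ge0 ?ler0n//; congr (_ * _).
    have [le|lt] := leqP cy (l * cx).
      by rewrite -natrB//; apply/max_idPl.
    rewrite (eqP (ltnW lt : _ - _ == 0)%N); apply/max_idPr.
    by rewrite subr_le0 ler_nat; exact: ltnW.
  move=> h /hrange[hh hc]; rewrite order_stat_le ?size_codom ?card_ord//.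
  rewrite ltNge order_stat_le ?size_codom ?card_ord//.
  by rewrite !count_codom -/cx -/cy cle -ltnNge andbC.
rewrite -mulrBr -sumrB normrM ger0_norm ?invr_ge0 ?ler0n// ler_pdivrMl//.
apply: (le_trans (ler_norm_sum _ _ _)).
have -> : (l * N)%:R * M%:R^-1 = \sum_(1 <= h < (l * N).+1) M%:R^-1 :> R.
  by rewrite sumr_const_nat subn1 mulr_natl.
rewrite big_nat_cond [leRHS]big_nat_cond; apply: ler_sum => h.
by rewrite andbT => /hrange[hh hc]; apply: levels_approx => //; exact: os01.
Qed.

(** * The comonotone coupling of two chains of sets *)

(* The length of the intersection of the intervals [F j, F (j + 1)] and
   [G k, G (k + 1)]: the mass that the quantile coupling gives to the cell (j, k). *)
Definition comonotone_mass (R : realType) (F G : nat -> R) (j k : nat) : R :=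
  Num.min (F j.+1) (G k.+1) - Num.min (F j) (G k.+1)
    - (Num.min (F j.+1) (G k) - Num.min (F j) (G k)).

(** [comonotone_mass] is the mixed second difference of the minimum, a supermodular function. *)
Lemma comonotone_mass_ge0 (R : realType) (F G : nat -> R) (j k : nat) :
  F j <= F j.+1 -> G k <= G k.+1 -> 0 <= comonotone_mass F G j k.
Proof.
rewrite /comonotone_mass => ? ?.
case: (leP (F j.+1) (G k.+1)) => ?; case: (leP (F j) (G k.+1)) => ?;
  case: (leP (F j.+1) (G k)) => ?; case: (leP (F j) (G k)) => ?; lra.
Qed.

Lemma sum_comonotone_massr (R : realType) (F G : nat -> R) (j n : nat) :
  \sum_(k < n) comonotone_mass F G j k =
  Num.min (F j.+1) (G n) - Num.min (F j) (G n)
    - (Num.min (F j.+1) (G 0%N) - Num.min (F j) (G 0%N)).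
Proof.
elim: n => [|n IH]; first by rewrite big_ord0 !subrr.
by rewrite big_ord_recr/= IH /comonotone_mass; ring.
Qed.

Lemma comonotone_massC (R : realType) (F G : nat -> R) (j k : nat) :
  comonotone_mass F G j k = comonotone_mass G F k j.
Proof. by rewrite /comonotone_mass ![Num.min (F _) _]minC; ring. Qed.

Lemma sum_comonotone_mass2 (R : realType) (F G : nat -> R) (n : nat) :
  F 0%N = 0 -> G 0%N = 0 -> 0 <= F n -> 0 <= G n ->
  \sum_(j < n) \sum_(k < n) comonotone_mass F G j k = Num.min (F n) (G n).
Proof.
move=> F0 G0 Fn Gn; under eq_bigr do rewrite sum_comonotone_massr.
suff H m : \sum_(i < m) (Num.min (F i.+1) (G n) - Num.min (F i) (G n) -
    (Num.min (F i.+1) (G 0%N) - Num.min (F i) (G 0%N))) =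
    Num.min (F m) (G n) - Num.min (F 0%N) (G n) -
    (Num.min (F m) (G 0%N) - Num.min (F 0%N) (G 0%N)).
  by rewrite H F0 G0 (min_l Gn) (min_r Fn) (min_l (lexx 0)) !subr0.
elim: m => [|m IH]; first by rewrite big_ord0 !subrr.
by rewrite big_ord_recr/= IH; ring.
Qed.

(* On a null cell the quotient is 0, which is harmless because the mass of that
   cell vanishes too. *)
Definition comonotone_weight (R : realType) (F G : nat -> R) (j k : nat) : R :=
  comonotone_mass F G j k / ((F j.+1 - F j) * (G k.+1 - G k)).

(** Frees the summand of the [G] increment, so that the sum over [k] telescopes; when that increment
    is 0 the mass vanishes too and both sides are 0. *)
Lemma comonotone_weightE (R : realType) (F G : nat -> R) (c : R) (j k : nat) :
  comonotone_weight F G j k * (c * (G k.+1 - G k)) =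
  comonotone_mass F G j k * (c / (F j.+1 - F j)).
Proof.
rewrite /comonotone_weight invfM.
have [Gk|Gk] := eqVneq (G k.+1 - G k) 0; last first.
  by rewrite [c * _]mulrC !mulrA mulfVK// [in RHS]mulrAC.
have -> : comonotone_mass F G j k = 0.
  by rewrite /comonotone_mass (subr0_eq Gk) subrr.
by rewrite !mul0r.
Qed.

Lemma comonotone_weightK (R : realType) (F G : nat -> R) (j k : nat) :
  comonotone_weight F G j k * ((F j.+1 - F j) * (G k.+1 - G k)) =
  comonotone_mass F G j k.
Proof.
rewrite comonotone_weightE.
have [Fj|Fj] := eqVneq (F j.+1 - F j) 0; last by rewrite mulfV ?mulr1.
by rewrite /comonotone_mass (subr0_eq Fj) !subrr mul0r.
Qed.

Lemma comonotone_weightC (R : realType) (F G : nat -> R) (j k : nat) :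
  comonotone_weight F G j k = comonotone_weight G F k j.
Proof.
by rewrite /comonotone_weight comonotone_massC [X in _ / X]mulrC.
Qed.

(** The marginal property of the coupling: [c j] will be the mass of a set inside the cell [j]. Row
    [j] of the masses telescopes to [F j.+1 - F j] because [G n] dominates [F], and this cancels the
    denominator. *)
Lemma sum_comonotone_weight (R : realType) (F G c : nat -> R) (n : nat) :
  (forall j, 0 <= F j <= G n) -> G 0%N = 0 ->
  (forall j, 0 <= c j <= F j.+1 - F j) ->
  \sum_(j < n) \sum_(k < n)
    comonotone_weight F G j k * (c j * (G k.+1 - G k)) = \sum_(j < n) c j.
Proof.
move=> FG G0 cF; apply: eq_bigr => j _.
under eq_bigr do rewrite comonotone_weightE.
rewrite -mulr_suml sum_comonotone_massr G0.
have /andP[Fj0 FjG] := FG j; have /andP[Fj0' FjG'] := FG j.+1.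
rewrite (min_l FjG) (min_l FjG') (min_r Fj0) (min_r Fj0') subrr subr0.
have [Fj|Fj] := eqVneq (F j.+1 - F j) 0; last by rewrite mulrCA mulfV ?mulr1.
by rewrite Fj mul0r; have := cF j; rewrite Fj -eq_le => /eqP.
Qed.

Lemma sum_ord_if (R : realType) (m n : nat) (f : nat -> R) : (m <= n)%N ->
  \sum_(j < n) (if (j < m)%N then f j else 0) = \sum_(j < m) f j.
Proof.
by move=> mn; rewrite (big_ord_widen n f mn) [RHS]big_mkcond.
Qed.

Section comonotone_coupling.
Context {R : realType} d (T : measurableType d) (mu nu : probability T R).
Variables (A B : (set T)^nat) (n : nat).
Hypotheses (mA : forall k, measurable (A k)) (mB : forall k, measurable (B k)).
Hypotheses (ndA : nondecreasing_seq A) (ndB : nondecreasing_seq B).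
Hypotheses (An : A n = setT) (Bn : B n = setT).

(** Shifted by one and set to 0 at 0, so that every cell, including the first, has an increment of
    [cumul] as its mass. *)
Let cumul (m : probability T R) (C : (set T)^nat) (k : nat) : R :=
  if k is k'.+1 then fine (m (C k')) else 0.

Let cell (m : probability T R) (C : (set T)^nat) (X : set T) (k : nat) : R :=
  fine (m (X `&` seqD C k)).

Let mseqD (C : (set T)^nat) k : (forall k, measurable (C k)) ->
  measurable (seqD C k).
Proof. by move=> mC; case: k => //= k; exact: measurableD. Qed.

Let sum_cell (m : probability T R) (C : (set T)^nat) (X : set T) k :
  (forall k, measurable (C k)) -> nondecreasing_seq C -> measurable X ->
  \sum_(i < k.+1) cell m C X i = fine (m (X `&` C k)).
Proof.
move=> mC ndC mX; elim: k => [|k IH]; first by rewrite big_ord_recr/= big_ord0 add0r.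
have mXC : measurable (X `&` C k) by exact: measurableI.
have mXD : measurable (X `&` (C k.+1 `\` C k)).
  by apply: measurableI => //; exact: measurableD.
have CC : C k `<=` C k.+1 by apply/subsetPset/ndC.
rewrite big_ord_recr/= IH /cell -fineD ?fin_num_measure//.
rewrite -measureU//=; first by rewrite -setIUr setDUK.
by apply/seteqP; split => // x [[_ Cx] [_ [_]]].
Qed.

Let cell_ge0 m C X k : 0 <= cell m C X k.
Proof. exact: fine_ge0. Qed.

Let cell_setT (m : probability T R) (C : (set T)^nat) k :
  (forall k, measurable (C k)) -> nondecreasing_seq C ->
  cell m C setT k = cumul m C k.+1 - cumul m C k.
Proof.
move=> mC ndC; case: k => [|k]; first by rewrite /cell setTI subr0.
rewrite /= -[C k.+1]setTI -[C k]setTI -!sum_cell// [in RHS]big_ord_recr/=.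
by rewrite addrAC subrr add0r.
Qed.

Let weight := comonotone_weight (cumul mu A) (cumul nu B).

Let cumul_le (m : probability T R) (C : (set T)^nat) k :
  (forall k, measurable (C k)) -> nondecreasing_seq C ->
  cumul m C k <= cumul m C k.+1.
Proof. by move=> mC ndC; rewrite -subr_ge0 -cell_setT. Qed.

Let weight_ge0 j k : 0 <= weight j k.
Proof.
apply: divr_ge0; last by rewrite -!cell_setT// mulr_ge0.
by apply: comonotone_mass_ge0; exact: cumul_le.
Qed.

Let mcell j k : measurable (seqD A j `*` seqD B k).
Proof. by apply: measurableX; exact: mseqD. Qed.

(** A multiple of the product measure on each pair of cells: the coordinates are independent within
    a pair, and the weights give each pair its comonotone mass. *)
Let comonotone : {measure set (T * T)%type -> \bar R} :=
  msum (fun j => msum (fun k => mscale (NngNum (weight_ge0 j k))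
    (mrestr (mu \x nu)%E (mcell j k))) n.+1) n.+1.

Let comonotoneE X Y : measurable X -> measurable Y ->
  comonotone (X `*` Y) =
  (\sum_(j < n.+1) \sum_(k < n.+1)
     weight j k * (cell mu A X j * cell nu B Y k))%:E.
Proof.
move=> mX mY; rewrite /comonotone /msum/= -sumEFin; apply: eq_bigr => j _.
rewrite /msum -sumEFin; apply: eq_bigr => k _.
rewrite -[LHS]/((weight j k)%:E *
  (mu \x nu) ((X `*` Y) `&` (seqD A j `*` seqD B k)))%E.
rewrite -setXI product_measure1E//=; last 2 first.
- by apply: measurableI => //; exact: mseqD.
- by apply: measurableI => //; exact: mseqD.
by rewrite !EFinM /cell !fineK ?fin_num_measure//;
  apply: measurableI => //; exact: mseqD.
Qed.

Let cumul_bound (m m' : probability T R) (C C' : (set T)^nat) k :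
  (forall k, measurable (C k)) -> C' n = setT ->
  0 <= cumul m C k <= cumul m' C' n.+1.
Proof.
move=> mC C'n; rewrite /= C'n probability_setT/=.
case: k => [|k] /=; first by rewrite lexx ler01.
by rewrite fine_ge0//= -lee_fin fineK ?probability_le1 ?fin_num_measure.
Qed.

Let cell_le (m : probability T R) (C : (set T)^nat) X k :
  (forall k, measurable (C k)) -> nondecreasing_seq C -> measurable X ->
  0 <= cell m C X k <= cumul m C k.+1 - cumul m C k.
Proof.
move=> mC ndC mX; rewrite cell_ge0/= -cell_setT//.
have mD := @mseqD C k mC.
have mXD : measurable (X `&` seqD C k) by exact: measurableI.
by rewrite fine_le ?fin_num_measure ?setTI// le_measure ?inE.
Qed.

Let cell_level (m : probability T R) (C : (set T)^nat) s k :
  (forall k, measurable (C k)) -> nondecreasing_seq C ->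
  cell m C (C s) k = if (k < s.+1)%N then cumul m C k.+1 - cumul m C k else 0.
Proof.
move=> mC ndC; rewrite ltnS -cell_setT// /cell; case: leqP => [ks|sk].
  congr (fine (m _)); rewrite setTI; apply: setIidr.
  apply: (@subset_trans _ (C k)); last by apply/subsetPset/ndC.
  by case: k {ks} => //= k x [].
rewrite (_ : _ `&` _ = set0) ?measure0//; apply/seteqP; split => // x [Cs].
case: k sk => // k sk /= [_]; apply; move: Cs.
by apply/subsetPset/ndC.
Qed.

Let comonotonel X : measurable X -> comonotone (X `*` setT) = mu X.
Proof.
move=> mX; rewrite comonotoneE//.
under eq_bigr do under eq_bigr do rewrite [cell nu B _ _]cell_setT//.
rewrite sum_comonotone_weight// => [|j|j]; last 2 first.
- exact: cumul_bound.
- exact: cell_le.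
by rewrite sum_cell// An setIT fineK// fin_num_measure.
Qed.

Let comonotoner X : measurable X -> comonotone (setT `*` X) = nu X.
Proof.
move=> mX; rewrite comonotoneE// exchange_big/=.
under eq_bigr do under eq_bigr do
  rewrite [cell mu A _ _]cell_setT// [_ * cell _ _ _ _]mulrC
    /weight comonotone_weightC.
rewrite sum_comonotone_weight// => [|j|j]; last 2 first.
- exact: cumul_bound.
- exact: cell_le.
by rewrite sum_cell// Bn setIT fineK// fin_num_measure.
Qed.

(** The rectangle is a union of whole pairs of cells, so only their total masses count, and these
    telescope. *)
Let comonotone_level s : (s <= n)%N ->
  comonotone (A s `*` B s) = (Num.min (fine (mu (A s))) (fine (nu (B s))))%:E.
Proof.
move=> sn; rewrite comonotoneE//.
have -> : Num.min (fine (mu (A s))) (fine (nu (B s))) =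
  Num.min (cumul mu A s.+1) (cumul nu B s.+1) by [].
rewrite -sum_comonotone_mass2//=; [|exact: fine_ge0..].
congr (_%:E).
have /= <- := sum_ord_if (fun j => \sum_(k < s.+1)
  comonotone_mass (cumul mu A) (cumul nu B) j k) (sn : s < n.+1)%N.
apply: eq_bigr => j _.
rewrite cell_level//; case: ifP => _; last first.
  by apply: big1 => k _; rewrite mul0r mulr0.
have /= <- := sum_ord_if (comonotone_mass (cumul mu A) (cumul nu B) j)
  (sn : s < n.+1)%N.
apply: eq_bigr => k _.
rewrite cell_level//; case: ifP => _; last by rewrite !mulr0.
exact: comonotone_weightK.
Qed.

(** The marginals make the minimum an upper bound for any coupling; for nested sets a single
    coupling attains it at all [s] at once. *)
Lemma comonotone_coupling_exists : exists2 w : probability (T * T)%type R,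
  coupling mu nu w & forall s, (s <= n)%N ->
    w (A s `*` B s) = (Num.min (fine (mu (A s))) (fine (nu (B s))))%:E.
Proof.
have w1 : comonotone setT = 1%E.
  by rewrite -setXTT comonotonel// probability_setT.
pose w : probability (T * T)%type R :=
  HB.pack (comonotone : set _ -> _) comonotone
    (Measure_isProbability.Build _ _ _ comonotone w1).
exists w; last exact: comonotone_level.
by move=> X mX; split; [exact: comonotonel|exact: comonotoner].
Qed.

End comonotone_coupling.

(** * The Wasserstein distance at the thresholds *)

Lemma integral_sum_indic d (T : measurableType d) (R : realType)
  (w : probability T R) (I : finType) (A : I -> set T) :
  (forall i, measurable (A i)) ->
  (\int[w]_p (\sum_i \1_(A i) p : R)%:E = \sum_i w (A i))%E.
Proof.
move=> mA; under eq_integral do rewrite -sumEFin.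
rewrite ge0_integral_sum//; last first.
  by move=> i; apply/measurable_EFinP; exact: measurable_indic.
by apply: eq_bigr => i _; rewrite integral_indic// setIT.
Qed.

Section wasserstein_levels.
Context {R : realType} d (T : measurableType d) (mu nu : probability T R).
Variables (f : T -> R) (M : nat).
Hypotheses (mf : measurable_fun setT f) (f01 : forall x, 0 <= f x <= 1).
Hypothesis M0 : (0 < M)%N.

Let level (k : nat) : set T := [set x | f x <= k%:R / M%:R].

Let level_measurable k : measurable (level k).
Proof.
rewrite -[level k]setTI.
rewrite [X in _ `&` X](_ : _ = f @^-1` `]-oo, k%:R / M%:R]).
  by apply: mf => //; exact: measurable_itv.
by apply/seteqP; split => x /=; rewrite in_itv.
Qed.

Let levels_indic x y :
  levels M (f x) (f y) =
  M%:R^-1 * \sum_(k < M) \1_(level k `*` ~` level k) (x, y).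
Proof.
congr (_ * _); apply: eq_bigr => k _; rewrite indicE; congr (nat_of_bool _)%:R.
apply/idP/idP => [/andP[xk ky]|/set_mem[/= xk ky]].
  by apply/mem_set; split => //=; apply/negP; rewrite -ltNge.
by rewrite xk ltNge; apply/negP.
Qed.

Let measurable_cell k : measurable (level k `*` ~` level k).
Proof. by apply: measurableX => //; exact: measurableC. Qed.

Let measurable_hemimetric :
  measurable_fun setT (fun p : T * T => (Num.max (f p.2 - f p.1) 0)%:E).
Proof.
apply/measurable_EFinP; apply: measurable_maxr => //.
by apply: measurable_funB; apply: measurableT_comp.
Qed.

Let measurable_levels :
  measurable_fun setT (fun p : T * T => (levels M (f p.1) (f p.2))%:E).
Proof.
apply/measurable_EFinP; under eq_fun do rewrite levels_indic.
apply: measurable_funM => //; apply: measurable_sum => k.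
by under eq_fun do rewrite -surjective_pairing; exact: measurable_indic.
Qed.

Let levels_ge0 (x y : R) : 0 <= levels M x y.
Proof. by rewrite mulr_ge0 ?invr_ge0// sumr_ge0. Qed.

Let integral_levels (w : probability (T * T)%type R) :
  (\int[w]_p (levels M (f p.1) (f p.2))%:E =
   (M%:R^-1 * \sum_(k < M) fine (w (level k `*` ~` level k)))%:E)%E.
Proof.
under eq_integral do rewrite levels_indic EFinM -surjective_pairing.
rewrite ge0_integralZl_EFin ?invr_ge0//; first last.
- apply/measurable_EFinP; apply: measurable_sum => k.
  exact: measurable_indic.
- by move=> p _; rewrite lee_fin sumr_ge0.
rewrite integral_sum_indic// EFinM -sumEFin; congr (_ * _)%E.
by apply: eq_bigr => k _; rewrite fineK// fin_num_measure.
Qed.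

Let integral_hemimetric (w : probability (T * T)%type R) :
  let V := M%:R^-1 * \sum_(k < M) fine (w (level k `*` ~` level k)) in
  is_true ((V - M%:R^-1)%:E <= \int[w]_p (Num.max (f p.2 - f p.1) 0)%:E <=
   (V + M%:R^-1)%:E)%E.
Proof.
move=> V.
have approx x y : levels M (f x) (f y) <= Num.max (f y - f x) 0 + M%:R^-1 /\
    Num.max (f y - f x) 0 <= levels M (f x) (f y) + M%:R^-1.
  by have := levels_approx M0 (f01 x) (f01 y); rewrite ler_norml; lra.
have intM : (\int[w]_p (M%:R^-1 : R)%:E = (M%:R^-1)%:E)%E.
  by rewrite integral_cst// [X in (_ * X)%E]probability_setT mule1.
have h0 (p : T * T) : 0 <= Num.max (f p.2 - f p.1) 0 by rewrite le_max lexx orbT.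
apply/andP; split.
  rewrite EFinB leeBlDr// /V -integral_levels -intM -ge0_integralD//; last first.
    by move=> p _; rewrite lee_fin.
  apply: ge0_le_integral => //.
  - by move=> p _; rewrite lee_fin.
  - by apply: emeasurable_funD.
  - by move=> p _; rewrite lee_fin; have [] := approx p.1 p.2.
rewrite EFinD /V -integral_levels -intM -ge0_integralD//; last first.
  by move=> p _; rewrite lee_fin.
apply: ge0_le_integral => //.
- by move=> p _; rewrite lee_fin.
- by apply: emeasurable_funD.
- by move=> p _; rewrite lee_fin; have [] := approx p.1 p.2.
Qed.

(** By the left marginal, a small cost at threshold [k] means a large mass on [level k] times
    itself, the quantity that the comonotone coupling maximises. *)
Let cell_measure (w : probability (T * T)%type R) k : coupling mu nu w ->
  fine (w (level k `*` ~` level k)) =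
  fine (mu (level k)) - fine (w (level k `*` level k)).
Proof.
move=> wc; have [<- _] := wc _ (level_measurable k).
have mk : measurable (level k `*` level k) by exact: measurableX.
rewrite [X in _ = fine (w X) - _](_ : _ =
    (level k `*` level k) `|` (level k `*` ~` level k)).
  rewrite measureU//; last first.
    by apply/seteqP; split => // -[x y] [[_ /= yk] [_]].
  by rewrite fineD ?fin_num_measure// addrAC subrr add0r.
apply/seteqP; split => [[x y] [xk _]|[x y] [] []//].
by have [yk|yk] := pselect (level k y); [left|right].
Qed.

Lemma wasserstein_levels :
  let V := grid_gap M (fun t => fine (mu [set x | f x <= t]))
    (fun t => fine (nu [set x | f x <= t])) in
  is_true ((V - M%:R^-1)%:E <=
   wasserstein (fun x y => Num.max (f y - f x) 0)%R mu nu <=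
   (V + M%:R^-1)%:E)%E.
Proof.
move=> V; apply/andP; split.
  (* Lower bound, for any coupling: the right marginal bounds the mass of [level k] times itself by
     that of [level k] under [nu]. *)
  apply/ereal_infP => _ [w wc <-].
  have /andP[+ _] := integral_hemimetric w; apply: le_trans.
  rewrite lee_fin lerD2r ler_wpM2l ?invr_ge0//; apply: ler_sum => k _.
  rewrite ge_max fine_ge0// andbT cell_measure// lerD2l lerN2.
  have [_ <-] := wc _ (level_measurable k).
  have mk : measurable (level k `*` level k) by exact: measurableX.
  have mTk : measurable ([set: T] `*` level k) by exact: measurableX.
  apply: fine_le; rewrite ?fin_num_measure//.
  rewrite le_measure ?inE//.
  by move=> [x y] [].
(* Upper bound: as [f <= 1], the chain of level sets reaches the whole space at index [M], as the
   coupling requires. *)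
have levelT k : (M <= k)%N -> level k = setT.
  move=> Mk; apply/seteqP; split => // x _; rewrite /level/=.
  have /andP[_ /le_trans] := f01 x; apply.
  by rewrite ler_pdivlMr ?ltr0n// mul1r ler_nat.
have ndlevel : nondecreasing_seq level.
  move=> i j ij; apply/subsetPset => x /le_trans; apply.
  by rewrite ler_wpM2r ?invr_ge0// ler_nat.
have [w wc wE] := comonotone_coupling_exists mu nu level_measurable
  level_measurable ndlevel ndlevel (levelT M (leqnn M)) (levelT M (leqnn M)).
apply: (@le_trans _ _ (\int[w]_p (Num.max (f p.2 - f p.1) 0)%:E)%E).
  by apply: ereal_inf_lbound; exists w.
have /andP[_ /le_trans] := integral_hemimetric w; apply.
rewrite lee_fin lerD2r ler_wpM2l ?invr_ge0//; apply: ler_sum => k _.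
rewrite cell_measure// wE 1?ltnW//=.
have sub_min (u v : R) : u - Num.min u v <= Num.max (u - v) 0.
  by rewrite le_max; case: (leP u v) => ?; apply/orP; [right|left]; lra.
exact: sub_min.
Qed.

End wasserstein_levels.

(** * The law of large numbers for triangular arrays *)

Lemma prod_1DZ (R : comNzRingType) (I : finType) (s : R) (u : I -> R) :
  \prod_i (1 + s * u i) = \sum_(J : {set I}) s ^+ #|J| * \prod_(i in J) u i.
Proof.
under eq_bigr do rewrite addrC.
rewrite bigA_distr; apply: eq_bigr => J _.
by rewrite -big_mkcond/= big_split/= prodr_const.
Qed.

Section law_of_large_numbers.
Context {R : realType} dO (O : measurableType dO) (Pr : probability O R).
Context dT (T : measurableType dT) (mu : probability T R).
Implicit Type b : T -> bool.

Let preimage_measurable (X : {RV Pr >-> T}) b : measurable [set x | b x] ->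
  measurable (X @^-1` [set x | b x]).
Proof.
by move=> mb; rewrite -[_ @^-1` _]setTI; apply: measurable_funPT.
Qed.

Let indicator_measurable (X : {RV Pr >-> T}) b : measurable [set x | b x] ->
  measurable_fun setT (fun o => (b (X o))%:R : R).
Proof.
move=> mb; rewrite (_ : (fun o => _) = \1_(X @^-1` [set x | b x])).
  by apply: measurable_indic; exact: preimage_measurable.
apply/funext => o; rewrite indicE; congr (nat_of_bool _)%:R.
by apply/idP/idP => [bo|/set_mem//]; exact/mem_set.
Qed.

(** Independence is a product formula for events, so the product is expanded over subsets [J]: a
    product of indicators over [J] is the indicator of an intersection of events. *)
Lemma expectation_prod_independent n (X : 'I_n -> {RV Pr >-> T}) b (s : R) :
  independent_samples mu X -> measurable [set x | b x] -> 0 <= s ->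
  (\int[Pr]_o (\prod_(j < n) (1 + s * (b (X j o))%:R))%:E)%E =
  ((1 + s * fine (mu [set x | b x])) ^+ n)%:E.
Proof.
move=> [indX muX] mb s0; set p := fine _.
pose E (J : {set 'I_n}) := \bigcap_(j in [set` J]) X j @^-1` [set x | b x].
have mE J : measurable (E J).
  by apply: fin_bigcap_measurable => // j _; exact: preimage_measurable.
have prod_indic (J : {set 'I_n}) o : \prod_(j in J) (b (X j o))%:R = \1_(E J) o :> R.
  rewrite indicE; have [oE|oE] := boolP (o \in E J).
    by apply: big1 => j jJ; move/set_mem : oE => /(_ j jJ) /= ->.
  have /existsP[j /andP[jJ bj]] : [exists j, (j \in J) && ~~ b (X j o)].
    apply: contraNT oE => /existsPn H; apply/mem_set => j /= jJ.
    by have := H j; rewrite jJ/= negbK.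
  by rewrite mulr0n; apply/eqP/prodf_eq0; exists j => //; rewrite pnatr_eq0 eqb0.
have PrE (J : {set 'I_n}) : Pr (E J) = (p ^+ #|J|)%:E.
  rewrite (indX J (fun=> [set x | b x]))//.
  rewrite (eq_bigr (fun=> p%:E)); last first.
    by move=> j _; rewrite fineK ?fin_num_measure// -(muX j).
  by rewrite -prodr_const (big_morph EFin (@EFinM R) erefl).
under eq_integral do rewrite prod_1DZ -sumEFin.
rewrite ge0_integral_sum//; first last.
- by move=> J o _; rewrite lee_fin mulr_ge0 ?exprn_ge0// prodr_ge0.
- move=> J; apply/measurable_EFinP; apply: measurable_funM => //.
  by under eq_fun do rewrite prod_indic; exact: measurable_indic.
have -> : ((1 + s * p) ^+ n)%:E = (\prod_(j < n) (1 + s * p))%:E.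
  by rewrite prodr_const card_ord.
rewrite prod_1DZ -sumEFin; apply: eq_bigr => J _.
under eq_integral do rewrite EFinM prod_indic.
rewrite ge0_integralZl_EFin ?exprn_ge0//; last first.
  by apply/measurable_EFinP; exact: measurable_indic.
by rewrite prodr_const EFinM -PrE integral_indic// setIT.
Qed.

Lemma measurable_count_ge n (X : 'I_n -> {RV Pr >-> T}) b (a : R) :
  measurable [set x | b x] ->
  measurable [set o | a <= (\sum_(j < n) b (X j o))%:R].
Proof.
move=> mb; rewrite -[X in measurable X]setTI.
have mS : measurable_fun setT (fun o => (\sum_(j < n) b (X j o))%:R : R).
  under eq_fun do rewrite natr_sum; apply: measurable_sum => j.
  exact: indicator_measurable.
rewrite [X in _ `&` X](_ : _ =
  (fun o => (\sum_(j < n) b (X j o))%:R : R) @^-1` `[a, +oo[).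
  by apply: mS => //; exact: measurable_itv.
by apply/seteqP; split => o /=; rewrite in_itv/= andbT.
Qed.

(** Markov inequality for the exponential of [r] times the count, whose mean factorises by
    independence. *)
Lemma chernoff n (X : 'I_n -> {RV Pr >-> T}) b (a r : R) :
  independent_samples mu X -> measurable [set x | b x] -> 0 <= r ->
  (Pr [set o | n%:R * a <= (\sum_(j < n) b (X j o))%:R]%R <=
   ((expR (- (r * a)) * (1 + (expR r - 1) * fine (mu [set x | b x]))) ^+ n)%:E)%E.
Proof.
move=> sX mb r0; set F := [set o | _].
have mF : measurable F by exact: measurable_count_ge.
have s0 : 0 <= expR r - 1 by rewrite subr_ge0 -expR0 ler_expR.
(* As b is boolean, exp (r * b) = 1 + (exp r - 1) * b. *)
have prodE o : \prod_(j < n) (1 + (expR r - 1) * (b (X j o))%:R) =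
    expR (r * (\sum_(j < n) b (X j o))%:R).
  rewrite natr_sum mulr_sumr expR_sum; apply: eq_bigr => j _.
  by case: (b _); rewrite ?mulr1 ?mulr0 ?expR0 ?addr0// addrC subrK.
rewrite exprMn EFinM -(expectation_prod_independent sX)//.
rewrite -ge0_integralZl_EFin ?exprn_ge0 ?expR_ge0//; last 2 first.
- by move=> o _; rewrite lee_fin prodE expR_ge0.
- apply/measurable_EFinP; apply: measurable_prod => j _.
  apply: measurable_funD => //; apply: measurable_funM => //.
  exact: indicator_measurable.
rewrite -[X in (Pr X <= _)%E]setIT -integral_indic//.
apply: ge0_le_integral => //.
- by apply/measurable_EFinP; exact: measurable_indic.
- apply/measurable_EFinP; apply: measurable_funM => //.
  apply: measurable_prod => j _; apply: measurable_funD => //.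
  by apply: measurable_funM => //; exact: indicator_measurable.
move=> o _; rewrite -EFinM lee_fin prodE -expRM_natr -expRD indicE.
have [oF|oF] := boolP (o \in F); last by rewrite expR_ge0.
move/set_mem : oF => /= oF; rewrite -[leLHS]/(1 : R) -[leLHS]expR0 ler_expR.
by have := ler_wpM2l r0 oF; lra.
Qed.

(** To first order in [r] the expression is 1 - r (a - p), so a small positive [r] works. *)
Let chernoff_rate (p a : R) : 0 <= p <= 1 -> p < a ->
  exists2 r : R, 0 <= r & expR (- (r * a)) * (1 + (expR r - 1) * p) < 1.
Proof.
move=> /andP[p0 p1] pa.
(* The factor 4 gives [4 * r <= a - p], so the exponent is at most - 4 r^2 + 2 r^2 p < 0; the cap 1
   gives [r <= 1 / 4], where the quadratic bound on the exponential holds. *)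
pose m := Num.min (a - p) 1; pose r : R := m / 4.
have m1 : m <= 1 by rewrite /m ge_min lexx orbT.
have ma : m <= a - p by rewrite /m ge_min lexx.
have m0 : 0 < m by rewrite /m lt_min ltr01 subr_gt0 pa.
have r0 : 0 < r by rewrite /r divr_gt0.
have r4 : r <= 1 / 4 by rewrite /r ler_wpM2r.
exists r; first exact: ltW.
(* Since exp (- r) >= 1 - r, exp r is at most 1 / (1 - r), which is at most 1 + r + 2 r^2 for 0 <= r
   <= 1/2. *)
have er : expR r - 1 <= r + 2 * r ^+ 2.
  have : expR r * (1 - r) <= 1.
    rewrite -[leRHS](mulfV (lt0r_neq0 (expR_gt0 r))) ler_pM2l ?expR_gt0//.
    by rewrite -expRN expR_ge1Dx.
  have : 0 < expR r by exact: expR_gt0.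
  nra.
have er0 : 0 <= expR r - 1 by rewrite subr_ge0 -expR0 ler_expR ltW.
apply: (@le_lt_trans _ _ (expR (- (r * a)) * expR ((expR r - 1) * p))).
  by rewrite ler_pM2l ?expR_gt0// expR_ge1Dx.
rewrite -expRD -expR0 ltr_expR expR0.
have mE : m = 4 * r by rewrite /r mulrCA mulfV ?mulr1.
have : (expR r - 1) * p <= (r + 2 * r ^+ 2) * p by rewrite ler_wpM2r.
have : r * p <= r * (a - 4 * r) by rewrite ler_wpM2l ?(ltW r0)//; lra.
have : r ^+ 2 * p <= r ^+ 2 by rewrite ler_piMr// sqr_ge0.
have : 0 < r ^+ 2 by rewrite exprn_gt0.
nra.
Qed.

(** Borel-Cantelli: the Chernoff tails are at most [q ^+ n N], hence at most [q ^+ N] since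
    [N <= n N], and these are summable. *)
Let ae_count_lt (n : nat -> nat) (X : forall N, 'I_(n N) -> {RV Pr >-> T}) b
    (a : R) :
  (forall N, N <= n N)%N ->
  (forall N, (1 <= N)%N -> independent_samples mu (X N)) ->
  measurable [set x | b x] -> fine (mu [set x | b x]) < a ->
  {ae Pr, forall o, \forall N \near \oo,
    (\sum_(j < n N) b (X N j o))%:R < (n N)%:R * a}.
Proof.
move=> nN sX mb; set p := fine _ => pa.
have p01 : 0 <= p <= 1.
  by rewrite fine_ge0//= -lee_fin fineK ?probability_le1 ?fin_num_measure.
have [r r0] := chernoff_rate p01 pa; set q := _ * _ => q1.
have q0 : 0 <= q.
  by rewrite mulr_ge0 ?expR_ge0// addr_ge0// mulr_ge0 ?subr_ge0 -?expR0 ?ler_expR//;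
    case/andP: p01.
pose F N := [set o | (n N)%:R * a <= (\sum_(j < n N) b (X N j o))%:R].
have mF N : measurable (F N) by exact: measurable_count_ge.
have PrF N : (Pr (F N) <= (q ^+ N)%:E)%E.
  (* The sampling hypothesis starts at [N = 1]; at 0 the bound is the trivial [q ^+ 0 = 1]. *)
  case: N => [|N]; first by rewrite expr0 probability_le1.
  apply: le_trans (chernoff a (sX N.+1 isT) mb r0) _.
  by rewrite lee_fin -/q ler_wiXn2l// ltW.
have : Pr (lim_sup_set F) = 0%E.
  apply: lim_sup_set_cvg0 => //.
  apply: (@le_lt_trans _ _ (\sum_(N <oo) (q ^+ N)%:E)%E).
    by apply: lee_nneseries => N *; [exact: measure_ge0|exact: PrF].
  have /cvg_lim -> : (\sum_(0 <= N < k) (q ^+ N)%:E)%E @[k --> \oo] -->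
      (1 * (1 - q)^-1)%:E => //; last exact: ltry.
  under eq_fun do rewrite sumEFin.
  apply: cvg_EFin; first exact: nearW.
  have := @cvg_geometric_series R 1 q; rewrite ger0_norm// => /(_ q1).
  by rewrite /series/= /geometric/=; under eq_fun do under eq_bigr do rewrite mul1r.
move=> PrF0; exists (lim_sup_set F); split => //.
  apply: bigcap_measurable => // k _.
  by apply: bigcup_measurable => j _; exact: mF.
move=> o /= H k _; apply: contrapT => Hk; apply: H.
exists k => // N /= kN; rewrite ltNge; apply/negP => oN; apply: Hk.
by exists N.
Qed.

(** A lower deviation of the count of [b] is an upper deviation of the count of its negation, so the
    one-sided bound is applied to both. *)
Lemma strong_law_of_large_numbers (n : nat -> nat)
    (X : forall N, 'I_(n N) -> {RV Pr >-> T}) b :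
  (forall N, N <= n N)%N ->
  (forall N, (1 <= N)%N -> independent_samples mu (X N)) ->
  measurable [set x | b x] ->
  {ae Pr, forall o, frequency R (fun j => b (X N j o)) @[N --> \oo] -->
    fine (mu [set x | b x])}.
Proof.
move=> nN sX mb; set p := fine _.
have mbC : measurable [set x | ~~ b x].
  rewrite (_ : [set x | _] = ~` [set x | b x]); first exact: measurableC.
  by apply/seteqP; split => x /= /negP.
have pC : fine (mu [set x | ~~ b x]) = 1 - p.
  rewrite (_ : [set x | ~~ b x] = ~` [set x | b x]).
    by rewrite probability_setC// fineB ?fin_num_measure.
  by apply/seteqP; split => x /= /negP.
have up m : {ae Pr, forall o, \forall N \near \oo,
    (\sum_(j < n N) b (X N j o))%:R < (n N)%:R * (p + m.+1%:R^-1)}.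
  by apply: ae_count_lt => //; rewrite ltrDl invr_gt0.
have lo m : {ae Pr, forall o, \forall N \near \oo,
    (\sum_(j < n N) ~~ b (X N j o))%:R < (n N)%:R * (1 - p + m.+1%:R^-1)}.
  by apply: (@ae_count_lt n X (fun x => ~~ b x)) => //; rewrite pC ltrDl invr_gt0.
apply: filterS2 (ae_foralln up) (ae_foralln lo) => o upo loo.
apply/cvgrPdist_lt => e e0.
have [m me] : exists m : nat, m.+1%:R^-1 < e.
  by have [m _ /(_ m (leqnn m)) /=] := near_infty_natSinv_lt (PosNum e0); exists m.
near=> N.
have n0 : (0 : R) < (n N)%:R.
  by rewrite ltr0n; apply: leq_trans (nN N); near: N; exact: nbhs_infty_gt.
have : (\sum_(j < n N) b (X N j o))%:R < (n N)%:R * (p + m.+1%:R^-1).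
  by near: N; exact: upo.
have : (\sum_(j < n N) ~~ b (X N j o))%:R < (n N)%:R * (1 - p + m.+1%:R^-1).
  by near: N; exact: loo.
have -> : (\sum_(j < n N) ~~ b (X N j o))%:R =
    (n N)%:R - (\sum_(j < n N) b (X N j o))%:R :> R.
  apply/eqP; rewrite eq_sym subr_eq -natrD -big_split/= eqr_nat.
  by under eq_bigr do rewrite addn_negb; rewrite sum1_card card_ord.
have -> : (\sum_(j < n N) b (X N j o))%:R =
    (n N)%:R * frequency R (fun j => b (X N j o)).
  by rewrite /frequency mulrA mulfV ?mul1r// gt_eqF.
rewrite -{1}[(n N)%:R]mulr1 -mulrBr !ltr_pM2l// distrC ltr_norml.
by move: me; move: (frequency _ _) (_^-1) => u v *; apply/andP; split; lra.
Unshelve. all: by end_near. Qed.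

End law_of_large_numbers.

(** * Measurability of penalty functions *)

Lemma rat_near (R : realType) (x d : R) : 0 < d ->
  exists q : rat, `|ratr q - x| < d.
Proof.
move=> d0; have [|q] := @rat_in_itvoo R (x - d) (x + d); first by lra.
by rewrite in_itv/= => /andP[q1 q2]; exists q; rewrite ltr_norml; lra.
Qed.

Section penalty_measurable.
Context {R : realType} (S : dataSpace R).

Lemma variable_value_measurable (k : 'I_(nvars S)) :
  measurable_fun setT (@variable_value R S k).
Proof.
move=> _ Y mY; rewrite setTI; apply: sub_sigma_algebra.
rewrite -bigcup_seq/=; exists k => /=; first by rewrite mem_index_enum.
by exists Y => //; rewrite setTI.
Qed.

(** The sigma-algebra is generated by the coordinates, so an open set is written as a union of boxes
    with rational centres and radii 1/(m + 1), of which there are countably many. *)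
Lemma open_dataState_measurable (U : set (dataState S)) : open U -> measurable U.
Proof.
move=> [V oV VU].
pose box (q : {ffun 'I_(nvars S) -> rat} * nat) : set (dataState S) :=
  \bigcap_(k in [set: 'I_(nvars S)])
    [set x | `|ratr (q.1 k) - variable_value k x| < q.2.+1%:R^-1].
have mbox q : measurable (box q).
  apply: fin_bigcap_measurable => // k _.
  have := @variable_value_measurable k measurableT _
    (measurable_ball (ratr (q.1 k)) q.2.+1%:R^-1).
  by rewrite setTI.
pose good q := box q `<=` U.
rewrite (_ : U = \bigcup_q (if `[< good q >] then box q else set0)).
  apply: countable_bigcupT_measurable => //.
  by move=> q; case: ifP.
apply/seteqP; split => [x Ux|x [q _]]; last by case: asboolP => [gq /gq|_ []].
have Vx : nbhs (set_val x) V.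
  by apply: open_nbhs_nbhs; split => //; move: Ux; rewrite -VU.
have /nbhs_ballP[e /= e0 eV] := Vx.
(* Two points of one box are each within the radius of its centre, so a radius below [e / 2] keeps
   the box inside the ball of radius [e] around [x]. *)
have e20 : 0 < e / 2 by rewrite divr_gt0.
have [m _ /(_ m (leqnn m)) /= me] := near_infty_natSinv_lt (PosNum e20).
have /choice[q xq] (k : 'I_(nvars S)) :
    exists q : rat, `|ratr q - variable_value k x| < m.+1%:R^-1.
  by apply: rat_near; rewrite invr_gt0.
exists ([ffun k => q k], m) => //.
case: asboolP => [_ k _|]; first by rewrite /= ffunE.
apply: contra_notP => _ y /= xy; rewrite -VU; apply: eV; split => // i k.
have close (a b c : R) : `|c - a| < m.+1%:R^-1 -> `|c - b| < m.+1%:R^-1 ->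
    `|a - b| < e.
  move: me; move: (_^-1) => d; rewrite !ltr_norml; lra.
rewrite !ord1; apply: (close _ _ (ratr (q k)) (xq k)).
by have := xy k Logic.I; rewrite /= ffunE.
Qed.

Lemma continuous_dataState_measurable (f : dataState S -> R) :
  continuous f -> measurable_fun setT f.
Proof.
move=> cf; apply: (measurability _ (RGenOpens.measurableE R)).
move=> _ [_ [a [b ->]] <-]; rewrite setTI; apply: open_dataState_measurable.
by move/continuousP : cf; apply; exact: interval_open.
Qed.

End penalty_measurable.

(** * Passage to the limit *)

Lemma cvg_max0 (R : realType) (u : nat -> R) (x : R) :
  u N @[N --> \oo] --> x -> Num.max (u N) 0 @[N --> \oo] --> Num.max x 0.
Proof.
have maxE (y : R) : Num.max y 0 = 2^-1 * (y + `|y|).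
  by case: (leP y 0) => y0; [rewrite ler0_norm//|rewrite gtr0_norm//]; lra.
move=> ux; rewrite maxE; under eq_fun do rewrite maxE.
by apply: cvgMl_tmp; apply: cvgD => //; exact: cvg_norm.
Qed.

Lemma grid_gap_cvg (R : realType) (M : nat) (FN GN : nat -> R -> R)
    (F G : R -> R) :
  (forall k : nat, FN N (k%:R / M%:R) @[N --> \oo] --> F (k%:R / M%:R)) ->
  (forall k : nat, GN N (k%:R / M%:R) @[N --> \oo] --> G (k%:R / M%:R)) ->
  grid_gap M (FN N) (GN N) @[N --> \oo] --> grid_gap M F G.
Proof.
move=> F_cvg G_cvg; apply: cvgMl_tmp; elim: (index_enum _) => [|k r IH].
  by under eq_fun do rewrite big_nil; rewrite big_nil; exact: cvg_cst.
under eq_fun do rewrite big_cons; rewrite big_cons; apply: cvgD => //.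
by apply: cvg_max0; apply: cvgB.
Qed.

Theorem theorem5p4 (R : realType) (S : dataSpace R)
    (dP : measure_display) (P : measurableType dP)
    (powerset_P : forall A : set P, measurable A)
    (cstep : (R.-pker dataState S ~> dataState S) ->
       R.-pker (P * dataState S)%type ~> (P * dataState S)%type)
    (c1 c2 : configuration P S) (i : nat)
    (rho : dataState S -> R) (rho_penalty : penalty_function rho)
    (l : nat) (l_ge1 : (1 <= l)%N)
    (dO : measure_display) (O : measurableType dO) (Pr : probability O R)
    (X1 : forall N : nat, 'I_N -> {RV Pr >-> (P * dataState S)%type})
    (X2 : forall N : nat, 'I_(l * N) -> {RV Pr >-> (P * dataState S)%type})
    (X1_samples : forall N : nat, (1 <= N)%N ->
       independent_samples (multistep cstep c1 i) (X1 N))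
    (X2_samples : forall N : nat, (1 <= N)%N ->
       independent_samples (multistep cstep c2 i) (X2 N)) :
  {ae Pr, forall t : O,
    (estimator (fun j => rho (X1 N j t).2) (fun h => rho (X2 N h t).2))%:E
      @[N --> \oo] -->
    wasserstein (penalty_hemimetric rho)
      (evolution_sequence cstep c1 i) (evolution_sequence cstep c2 i)}.
Proof.
have [rho_cont rho01] := rho_penalty.
have mrho := continuous_dataState_measurable rho_cont.
pose mu := evolution_sequence cstep c1 i.
pose nu := evolution_sequence cstep c2 i.
have mle (M k : nat) :
    measurable [set x : P * dataState S | rho x.2 <= k%:R / M%:R].
  rewrite -[X in measurable X]setTI.
  rewrite [X in _ `&` X](_ : _ = (rho \o snd) @^-1` `]-oo, k%:R / M%:R]).
    by apply: (measurableT_comp mrho measurable_snd) => //; exact: measurable_itv.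
  by apply/seteqP; split => x /=; rewrite in_itv.
have lln1 M k :=
  strong_law_of_large_numbers (fun N => leqnn N) X1_samples (mle M k).
have lln2 M k :=
  strong_law_of_large_numbers (fun N => leq_pmull N l_ge1) X2_samples (mle M k).
(* There are countably many pairs (M, k), so one almost sure event serves all thresholds. *)
apply: filterS2 (ae_foralln (fun M => ae_foralln (lln1 M)))
  (ae_foralln (fun M => ae_foralln (lln2 M))) => o F_cvg G_cvg.
pose F (t : R) := fine (mu [set x | rho x <= t]).
pose G (t : R) := fine (nu [set x | rho x <= t]).
have WM M : (0 < M)%N ->
    ((grid_gap M F G - M%:R^-1)%:E <=
    wasserstein (penalty_hemimetric rho) mu nu <= (grid_gap M F G + M%:R^-1)%:E)%E.
  by move=> M0; exact: wasserstein_levels.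
pose FN N (t : R) := frequency R (fun j : 'I_N => rho (X1 N j o).2 <= t).
pose GN N (t : R) := frequency R (fun j : 'I_(l * N) => rho (X2 N j o).2 <= t).
have gap_cvg M : grid_gap M (FN N) (GN N) @[N --> \oo] --> grid_gap M F G.
  (* The law of the data state is the image of the law of the configuration under [snd], so these
     limits are, by conversion, those of the law of large numbers. *)
  by apply: grid_gap_cvg => k; [exact: F_cvg|exact: G_cvg].
have Wfin : wasserstein (penalty_hemimetric rho) mu nu \is a fin_num.
  have /andP[lo hi] := WM 1%N isT; rewrite fin_numE.
  by rewrite gt_eqF ?(lt_le_trans _ lo) ?ltNyr//= lt_eqF// (le_lt_trans hi) ?ltry.
rewrite -(fineK Wfin); apply: cvg_EFin; first exact: nearW.
apply/cvgrPdist_lt => e e0.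
(* Three errors: discretising the distance, discretising the estimator, and the convergence of the
   empirical gap. The bounds on the first two do not depend on [N], so the grid [m.+1] is fixed
   before [N] grows. *)
have e30 : 0 < e / 3 by rewrite divr_gt0.
have [m _ /(_ m (leqnn m)) /= me] := near_infty_natSinv_lt (PosNum e30).
have /andP[] := WM m.+1 isT; rewrite -(fineK Wfin) !lee_fin => lo hi.
have /cvgrPdist_lt/(_ _ e30) gap_near := gap_cvg m.+1.
near=> N.
have N0 : (0 < N)%N by near: N; exact: nbhs_infty_gt.
have near_gap : `|grid_gap m.+1 F G - grid_gap m.+1 (FN N) (GN N)| < e / 3.
  by near: N.
have near_est : `|estimator (fun j => rho (X1 N j o).2) (fun h => rho (X2 N h o).2)
    - grid_gap m.+1 (FN N) (GN N)| <= m.+1%:R^-1.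
  exact: estimator_approx.
have triangle (w s a b d : R) : a - d <= w -> w <= a + d -> `|a - b| < e / 3 ->
    `|s - b| <= d -> d < e / 3 -> `|w - s| < e.
  by rewrite !ltr_norml ler_norml; lra.
exact: triangle lo hi near_gap near_est me.
Unshelve. all: by end_near. Qed.
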